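(* Let $K$ be a commutative field, let $x_1,\ldots,x_r\in K$ be pairwise distinct, and let $m_1,\ldots,m_r$ be positive integers. Let $\omega,\phi_i,h_i\in K[t]$ be the polynomials defined in the context. Then for each $i\in\{1,\ldots,r\}$ the polynomial $h_i$ is divisible by $\phi_i$ in $K[t]$; and if $s_i\in K[t]$ denotes the remainder of the polynomial $h_i/\phi_i$ upon division by $(t-x_i)^{m_i}$ (so $\deg s_i<m_i$), then $$\sum_{i=1}^r s_i(t)\,\phi_i(t)=1 ,$$ and, writing $s_i(t)=\sum_{k=1}^{m_i}a_{ik}(t-x_i)^{m_i-k}$ with $a_{ik}\in K$, one has in $K(t)$ the partial fraction decomposition $$\frac{1}{\omega(t)}=\sum_{i=1}^r\frac{s_i(t)}{(t-x_i)^{m_i}}=\sum_{i=1}^r\sum_{k=1}^{m_i}\frac{a_{ik}}{(t-x_i)^k}.$$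
   Context: Notation: $\omega(t)=\prod_{j=1}^r (t-x_j)^{m_j}$. For each $i\in\{1,\ldots,r\}$ set $$\phi_i(t)=\prod_{j\ne i}(t-x_j)^{m_j},\qquad q_i(t)=\frac{\phi_i(t)}{\phi_i(x_i)},\qquad h_i(t)=1-\left(1-q_i(t)\right)^{m_i}.$$ Empty products equal $1$. *)

(* Defs.v *)
From mathcomp Require Import all_boot all_algebra.

Set Implicit Arguments.
Unset Strict Implicit.
Unset Printing Implicit Defensive.

Import GRing.Theory.
Local Open Scope ring_scope.

Notation "p %:F" := (@FracField.tofrac _ p) : ring_scope.

Section PartialFractions.

Variables (K : fieldType) (r : nat) (x : 'I_r -> K) (m : 'I_r -> nat).

Definition omega : {poly K} := \prod_(j < r) ('X - (x j)%:P) ^+ m j.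

Definition phi (i : 'I_r) : {poly K} :=
  \prod_(j < r | j != i) ('X - (x j)%:P) ^+ m j.

Definition q (i : 'I_r) : {poly K} := ((phi i).[x i])^-1 *: phi i.

Definition h (i : 'I_r) : {poly K} := 1 - (1 - q i) ^+ m i.

(* The quotient is the Euclidean one; it is h_i / phi_i in the exact sense
   as soon as phi_i divides h_i. *)
Definition s (i : 'I_r) : {poly K} :=
  (h i %/ phi i) %% (('X - (x i)%:P) ^+ m i).

End PartialFractions.

(* Main.v *)
Require Import Defs.
From mathcomp Require Import all_boot all_algebra.

Set Implicit Arguments.
Unset Strict Implicit.
Unset Printing Implicit Defensive.

Import GRing.Theory.
Local Open Scope ring_scope.

(** Write P_i for the power of 'X - x_i in omega, so omega = P_i * phi_i.
    The polynomials h_i behave like the idempotents of the Chinese remainder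
    theorem: q_i takes the value 1 at x_i, so P_i divides 1 - h_i = (1 - q_i)^m_i,
    whereas phi_i, hence P_j for each j <> i, divides h_i.  Replacing h_i / phi_i
    by its remainder s_i modulo P_i changes h_i only by a multiple of omega
    ([omega_dvd_hsub]), so s_i * phi_i is still 1 modulo P_i
    ([s_phi_congr_id]); it is 0 modulo the other P_j as a multiple of phi_i
    ([s_phi_congr_other]).  The sum of the s_i * phi_i is therefore congruent to 1
    modulo every P_i, and modulo omega by coprimality ([prod_dvdp]).  As both the
    sum and 1 have degree less than that of omega, they are equal.  The
    decomposition of 1 / omega is this identity divided by omega, and its refined
    form comes from expanding s_i in powers of 'X - x_i. *)

(** * Polynomials over a field *)

Lemma prod_dvdp (K : fieldType) (I : eqType) (l : seq I) (F : I -> {poly K})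
    (p : {poly K}) :
    uniq l -> {in l &, forall i j, i != j -> coprimep (F i) (F j)} ->
    {in l, forall i, F i %| p} ->
  \prod_(i <- l) F i %| p.
Proof.
elim: l => [|i l IHl] /= => [_ _ _|/andP[il ul] cop dvd].
  by rewrite big_nil dvd1p.
rewrite big_cons Gauss_dvdp; last first.
  rewrite big_seq; elim/big_rec: _ => [|j q jl cq]; first exact: coprimep1.
  rewrite coprimepMr cq andbT cop ?inE ?eqxx ?jl ?orbT //.
  by apply: contraNneq il => ->.
rewrite dvd ?mem_head // IHl //.
  by move=> j k jl kl; apply: cop; rewrite inE ?jl ?kl orbT.
by move=> j jl; apply: dvd; rewrite inE jl orbT.
Qed.

(** Substituting 'X + c turns powers of 'X - c into powers of 'X, so the
    coefficients are read off p \Po ('X + c%:P); they are listed backwards,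
    from the power n - 1 down to 0. *)
Lemma exp_XsubC_expansion (K : fieldType) (c : K) (p : {poly K}) (n : nat) :
    (size p <= n)%N ->
  exists a : nat -> K,
    p = \sum_(1 <= k < n.+1) a k *: ('X - c%:P) ^+ (n - k).
Proof.
move=> szp; pose t := p \Po ('X + c%:P).
have szt : size t = size p by rewrite size_comp_poly2 // size_XaddC.
exists (fun k => t`_(n - k)).
rewrite big_add1 big_nat_rev /= -[LHS](comp_polyXaddC_K p c) -/t comp_polyE.
rewrite szt big_mkord (big_ord_widen n (fun k => t`_k *: _ ^+ k)) //.
rewrite [RHS](bigID (fun i : 'I_n => (i < size p)%N)) /=.
have pos (i : 'I_n) : (n - (0 + n - i.+1).+1 = i)%N.
  by rewrite add0n subnSK // subKn // ltnW.
rewrite [X in _ = _ + X]big1 ?addr0 => [|i]; first by apply: eq_bigr => i _; rewrite pos.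
by rewrite -leqNgt -szt pos => szi; rewrite nth_default // scale0r.
Qed.

(** * The identity for the remainders *)

Section Bezout.

Variables (K : fieldType) (r : nat) (x : 'I_r -> K) (m : 'I_r -> nat).
Hypothesis x_inj : injective x.

Local Notation P i := (('X - (x i)%:P) ^+ m i).

Lemma omegaE i : omega x m = P i * phi x m i.
Proof. by rewrite /omega (bigD1 i). Qed.

Lemma monic_P i : P i \is monic.
Proof. by rewrite monic_exp // monicXsubC. Qed.

Lemma monic_phi i : phi x m i \is monic.
Proof. by apply: monic_prod => j _; apply: monic_P. Qed.

Lemma monic_omega : omega x m \is monic.
Proof. by apply: monic_prod => j _; apply: monic_P. Qed.

Lemma size_P i : size (P i) = (m i).+1.
Proof. by rewrite size_exp_XsubC. Qed.

Lemma phi_neq0_at i : (phi x m i).[x i] != 0.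
Proof.
rewrite horner_prod; apply/prodf_neq0 => j ji.
by rewrite horner_exp expf_neq0 // hornerXsubC subr_eq0 inj_eq // eq_sym.
Qed.

(** With y = 1 - q_i, the polynomial h_i = 1 - y^m_i is a multiple of
    1 - y = q_i. *)
Lemma phi_dvd_h i : phi x m i %| h x m i.
Proof.
rewrite /h -[X in X - _](expr1n _ (m i)) subrXX dvdp_mulr //.
by rewrite subKr /q dvdpZr // invr_eq0 phi_neq0_at.
Qed.

(** Here 1 - h_i = (1 - q_i)^m_i, and x_i is a root of 1 - q_i by the
    normalisation of q_i. *)
Lemma P_dvd_1subh i : P i %| 1 - h x m i.
Proof.
rewrite /h subKr dvdp_exp2r // dvdp_XsubCl /root /q !hornerE.
by rewrite mulVf ?phi_neq0_at // subrr.
Qed.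

Lemma size_s i : (size (s x m i) <= m i)%N.
Proof. by rewrite -ltnS -size_P ltn_modp monic_neq0 ?monic_P. Qed.

(** A multiple of P_i is dropped from h_i / phi_i on passing to s_i, hence a
    multiple of P_i * phi_i = omega from h_i. *)
Lemma omega_dvd_hsub i : omega x m %| h x m i - s x m i * phi x m i.
Proof.
rewrite -{1}(divpK (phi_dvd_h i)) -mulrBl (omegaE i).
rewrite dvdp_mul2r ?monic_neq0 ?monic_phi // /s.
have := divp_eq (h x m i %/ phi x m i) (P i).
by move/esym/(canRL (addrK _)) <-; rewrite dvdp_mull.
Qed.

Lemma s_phi_congr_id i : P i %| 1 - s x m i * phi x m i.
Proof.
have -> : 1 - s x m i * phi x m i =
    (1 - h x m i) + (h x m i - s x m i * phi x m i) by rewrite addrA subrK.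
rewrite dvdp_add ?P_dvd_1subh //.
by apply: dvdp_trans (omega_dvd_hsub i); rewrite (omegaE i) dvdp_mulr.
Qed.

Lemma s_phi_congr_other i j : j != i -> P i %| s x m j * phi x m j.
Proof. by move=> ji; rewrite dvdp_mull // /phi (bigD1 i) 1?eq_sym //= dvdp_mulr. Qed.

Lemma omega_dvd_sum_sub1 : omega x m %| \sum_(i < r) s x m i * phi x m i - 1.
Proof.
apply: prod_dvdp => [|i j _ _ ij|i _]; first exact: index_enum_uniq.
  apply/coprimep_expl/coprimep_expr.
  by rewrite coprimep_XsubC root_XsubC inj_eq // eq_sym.
rewrite (bigD1 i) //= addrAC dvdp_add //.
  by rewrite -dvdpNr opprB s_phi_congr_id.
by elim/big_rec: _ => [|j p ji Pp]; rewrite ?dvdp0 // dvdp_add // s_phi_congr_other.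
Qed.

Lemma size_s_phi i : (size (s x m i * phi x m i)%R < size (omega x m))%N.
Proof.
have phi_gt0 : (0 < size (phi x m i))%N by rewrite size_poly_gt0 monic_neq0 ?monic_phi.
rewrite (omegaE i) (size_monicM (monic_P i)) ?monic_neq0 ?monic_phi // size_P addSn /=.
apply: leq_ltn_trans (size_polyMleq _ _) _.
by rewrite prednK ?leq_add2r ?size_s // addn_gt0 phi_gt0 orbT.
Qed.

Hypotheses (r_gt0 : (0 < r)%N) (m_gt0 : forall i, (0 < m i)%N).

Lemma size_omega_gt1 : (1 < size (omega x m))%N.
Proof.
pose i := Ordinal r_gt0.
apply: (@leq_trans (size (P i))); first by rewrite size_P ltnS m_gt0.
by rewrite dvdp_leq ?monic_neq0 ?monic_omega // (omegaE i) dvdp_mulr.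
Qed.

(** A multiple of omega of smaller degree than omega is zero. *)
Lemma sum_s_phi : \sum_(i < r) s x m i * phi x m i = 1.
Proof.
apply/eqP; rewrite -subr_eq0; apply: contraTT omega_dvd_sum_sub1 => nz.
apply/negP => /(dvdp_leq nz); apply/negP; rewrite -ltnNge.
apply: leq_ltn_trans (size_polyD _ _) _.
rewrite size_polyN size_poly1 gtn_max size_omega_gt1 andbT.
elim/big_ind: _ => [|p q sp sq|i _]; last exact: size_s_phi.
  by rewrite size_poly0 (ltn_trans _ size_omega_gt1).
by apply: leq_ltn_trans (size_polyD _ _) _; rewrite gtn_max sp.
Qed.

Lemma tofrac_P_neq0 i n : ((('X - (x i)%:P) ^+ n)%:F : {fraction {poly K}}) != 0.
Proof. by rewrite tofrac_eq0 expf_neq0 // polyXsubC_eq0. Qed.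

Lemma inv_omega :
  1 / (omega x m)%:F = \sum_(i < r) (s x m i)%:F / (P i)%:F
    :> {fraction {poly K}}.
Proof.
rewrite -[1 in LHS]tofrac1 -sum_s_phi rmorph_sum mulr_suml; apply: eq_bigr => i _ /=.
rewrite (omegaE i) !tofracM -mulf_div divff ?mulr1 //.
by rewrite tofrac_eq0 monic_neq0 ?monic_phi.
Qed.

End Bezout.

(** * The partial fraction decomposition *)

Theorem mainTheorem3 (K : fieldType) (r : nat) (x : 'I_r -> K)
    (m : 'I_r -> nat) (r_gt0 : (0 < r)%N) (x_inj : injective x)
    (m_gt0 : forall i : 'I_r, (0 < m i)%N) :
  (forall i : 'I_r, phi x m i %| h x m i) /\
  (forall i : 'I_r, (size (s x m i) <= m i)%N) /\
  \sum_(i < r) s x m i * phi x m i = 1 /\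
  1 / (omega x m)%:F =
    \sum_(i < r) (s x m i)%:F / (('X - (x i)%:P) ^+ m i)%:F
    :> {fraction {poly K}} /\
  (exists a : 'I_r -> nat -> K, forall i : 'I_r,
     s x m i = \sum_(1 <= k < (m i).+1) a i k *: ('X - (x i)%:P) ^+ (m i - k)) /\
  (forall a : 'I_r -> nat -> K,
     (forall i : 'I_r,
        s x m i =
          \sum_(1 <= k < (m i).+1) a i k *: ('X - (x i)%:P) ^+ (m i - k)) ->
     1 / (omega x m)%:F =
       \sum_(i < r) \sum_(1 <= k < (m i).+1)
         (a i k)%:P%:F / (('X - (x i)%:P) ^+ k)%:F
       :> {fraction {poly K}}).
Proof.
split; first exact: phi_dvd_h.
split; first exact: size_s.
split; first exact: sum_s_phi.
split; first exact: inv_omega.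
split.
  exact: fin_all_exists (fun i => exp_XsubC_expansion (x i) (size_s x m i)).
move=> a sE; rewrite (inv_omega x_inj r_gt0 m_gt0); apply: eq_bigr => i _.
rewrite [in LHS]sE rmorph_sum mulr_suml; apply: eq_big_nat => k /andP[_ km] /=.
(* Splitting P_i as a power m_i - k times a power k cancels the first factor. *)
rewrite -mul_polyC tofracM -[in X in _ / X](subnK (km : k <= m i)%N).
by rewrite exprD tofracM invfM mulrA mulfK ?tofrac_P_neq0.
Qed.
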